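(* Assume propositional truncations and function extensionality for $\mathbf{0}$-valued functions. Suppose $P,Q:\mathcal{U}\to\mathcal{U}$ are invariant under equivalence, that $P(Z)\vee Q(Z)$ holds for every $Z:\mathcal{U}$, and that there are types $X,Y:\mathcal{U}$ with $\neg P(X)$ and $\neg Q(Y)$. Then weak excluded middle holds.
   Context: Work in intensional Martin-Löf type theory with $\Pi$-, $\Sigma$-, identity, finite types and natural numbers, and a universe $\mathcal{U}$ closed under these, extended with propositional truncations $\|A\|$ (the universal proposition receiving a map from $A$). For propositions $A,B$, $A\vee B$ denotes $\|A+B\|$. $\neg A$ is $A\to\mathbf{0}$. Weak excluded middle: for all $A:\mathcal{U}$, $\neg A+\neg\neg A$. An equivalence is a map with a left and a right inverse; $X\simeq Y$ means there is an equivalence $X\to Y$. $P:\mathcal{U}\to\mathcal{U}$ is invariant under equivalence if $X\simeq Y$ implies $P(X)\simeq P(Y)$. *)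

(* Defs.v *)
(* Only the core of the standard library is used.  Martin-Lof type theory is
   embedded shallowly; nothing below or in the hypotheses uses axioms. *)

Set Implicit Arguments.
Unset Strict Implicit.

(* One fixed universe level: sharing this constant keeps all occurrences of
   the universe at the same level, which separate occurrences of [Type] would
   not do.  Identity types are [eq], which lies in [Prop], hence in [U]; its
   eliminator into [Type] is the usual J rule, and no uniqueness of identity
   proofs or proof irrelevance is assumed. *)
Definition U := Type.

(* [not] only applies to [Prop]; the empty type here is [Empty_set]. *)
Definition neg (A : U) : U := A -> Empty_set.

Definition is_prop (A : U) : U := forall x y : A, x = y.

Definition is_equiv (X Y : U) (f : X -> Y) : U :=
  ({g : Y -> X & forall x, g (f x) = x} *
   {h : Y -> X & forall y, f (h y) = y})%type.

Definition equiv (X Y : U) : U := {f : X -> Y & is_equiv f}.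

Definition invariant_under_equivalence (P : U -> U) : Type :=
  forall X Y : U, equiv X Y -> equiv (P X) (P Y).

(* Uniqueness in the universal property is automatic, the target being a
   proposition. *)
Record propositional_truncation : Type := PropositionalTruncation {
  trunc : U -> U;
  trunc_is_prop : forall A : U, is_prop (trunc A);
  trunc_in : forall A : U, A -> trunc A;
  trunc_rec : forall A B : U, is_prop B -> (A -> B) -> trunc A -> B
}.

(* Defined for all types, not only for propositions. *)
Definition disj (T : propositional_truncation) (A B : U) : U :=
  trunc T (A + B)%type.

Definition empty_valued_funext : Type :=
  forall (A : U) (f g : A -> Empty_set), (forall x, f x = g x) -> f = g.

Definition weak_excluded_middle : Type :=
  forall A : U, (neg A + neg (neg A))%type.

(* Main.v *)
(** For a type [A], let [Z] be [neg A * X + neg (neg A) * Y].  If [neg A] holds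
    then [Z] is equivalent to [X], so [P Z] refutes [neg A]; if [neg (neg A)]
    holds then [Z] is equivalent to [Y], so [Q Z] refutes [neg (neg A)].  Since
    negations are propositions by function extensionality, so is
    [neg A + neg (neg A)], and the truncated disjunction of [P Z] and [Q Z]
    may be eliminated into it. *)
Require Import Defs.

(** A point [x] would put [f x] in [Empty_set], so pointwise equality is vacuous. *)
Lemma is_prop_neg (funext0 : empty_valued_funext) (A : U) : is_prop (neg A).
Proof. intros f g; apply funext0; intro x; destruct (f x). Qed.

Lemma is_prop_sum (A B : U) :
  is_prop A -> is_prop B -> (A -> neg B) -> is_prop (A + B)%type.
Proof.
intros hA hB hAB [a | b] [a' | b'].
- now rewrite (hA a a').
- destruct (hAB a b').
- destruct (hAB a' b).
- now rewrite (hB b b').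
Qed.

(** [B] is contractible and [C] is empty, so the first summand collapses to [X] and the second
    vanishes. *)
Lemma equiv_sum_prod_left (B C X Y : U) :
  is_prop B -> B -> neg C -> equiv (B * X + C * Y)%type X.
Proof.
intros hB b nC.
exists (fun z => match z with
        | inl (_, x) => x
        | inr (c, _) => match nC c with end
        end).
(* One map serves as both left and right inverse. *)
split; exists (fun x => inl (b, x)).
- intros [[b' x] | [c y]]; [now rewrite (hB b b') | destruct (nC c)].
- reflexivity.
Defined.

Lemma equiv_sum_prod_right (B C X Y : U) :
  is_prop C -> C -> neg B -> equiv (B * X + C * Y)%type Y.
Proof.
intros hC c nB.
exists (fun z => match z with
        | inl (b, _) => match nB b with end
        | inr (_, y) => y
        end).
split; exists (fun y => inr (c, y)).
- intros [[b x] | [c' y]]; [destruct (nB b) | now rewrite (hC c c')].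
- reflexivity.
Defined.

Theorem theorem2p11
  (T : propositional_truncation)
  (funext0 : empty_valued_funext)
  (P Q : U -> U)
  (P_inv : invariant_under_equivalence P)
  (Q_inv : invariant_under_equivalence Q)
  (PQ : forall Z : U, disj T (P Z) (Q Z))
  (X Y : U)
  (nPX : neg (P X))
  (nQY : neg (Q Y)) :
  weak_excluded_middle.
Proof.
intro A.
refine (trunc_rec _ _ (PQ (neg A * X + neg (neg A) * Y)%type)).
- apply is_prop_sum; try apply (is_prop_neg funext0).
  intros n nn; exact (nn n).
- intros [p | q].
  + right; intro n; apply nPX.
    refine (projT1 (P_inv _ _ _) p).
    apply equiv_sum_prod_left; [apply (is_prop_neg funext0) | exact n |].
    intro nn; exact (nn n).
  + left; intro a; apply nQY.
    refine (projT1 (Q_inv _ _ _) q).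
    (* The remaining goals, [C] and [neg B], are both [neg (neg A)]; evaluation at [a] inhabits
       it. *)
    apply equiv_sum_prod_right; [apply (is_prop_neg funext0) | |];
      intro n; exact (n a).
Qed.
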